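(* For all $n\ge 4$, $$\sum_{\pi\in\mathfrak{S}_n,\ \mathcal{T}^{n-2}(\pi)=\mathrm{id}} x^{1+\mathrm{des}(\pi)} \;=\; A_n(x)-A_{\lceil (n-1)/2\rceil}(x)\,A_{\lfloor (n-1)/2\rfloor}(x).$$
   Context: $\mathfrak{S}_n$ is the set of permutations of $\{1,\ldots,n\}$, written as words; $\mathrm{id}=12\cdots n$; $\mathrm{des}(\pi)$ is the number of indices $i$ with $\pi_i>\pi_{i+1}$. $A_m(x)=\sum_{\pi\in\mathfrak{S}_m}x^{1+\mathrm{des}(\pi)}$ is the $m$th Eulerian polynomial ($m\ge 1$). The operator $\mathcal{T}$ (revstack sort) is defined recursively on finite words of distinct positive integers by $\mathcal{T}(\epsilon)=\epsilon$ for the empty word $\epsilon$, $\mathcal{T}(y)=y$ for a word $y$ of length 1, and $\mathcal{T}(LmR)=\mathcal{T}(R)\,\mathcal{T}(L)\,m$, where $m$ is the largest entry of $LmR$; $\mathcal{T}^{t}$ is its $t$-fold iterate. *)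

(* Defs.v *)
From mathcomp Require Import all_boot all_order all_fingroup all_algebra.

Set Implicit Arguments.
Unset Strict Implicit.
Unset Printing Implicit Defensive.

Import GRing.Theory.

(* 'S_n permutes {0, ..., n-1}; as a word it is written in the letters
   1, ..., n, so the identity is the word iota 1 n. *)
Definition word_of (n : nat) (p : 'S_n) : seq nat :=
  [seq (p i : nat).+1 | i <- enum 'I_n].

Definition des (w : seq nat) : nat :=
  \sum_(i < (size w).-1) (nth 0 w i > nth 0 w i.+1).

(* The first argument is fuel bounding the recursion depth; size w suffices,
   and revstack_cat below shows that revstack satisfies its recursion. *)
Fixpoint revstack_rec (k : nat) (w : seq nat) : seq nat :=
  if k is k'.+1 then
    if w is [::] then [::] else
      let m := \max_(x <- w) x in
      let i := index m w in
      revstack_rec k' (drop i.+1 w) ++ revstack_rec k' (take i w) ++ [:: m]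
  else [::].

Definition revstack (w : seq nat) : seq nat := revstack_rec (size w) w.

Lemma bigmax_mem (y : nat) (s : seq nat) : \max_(x <- y :: s) x \in y :: s.
Proof.
elim: s y => [|z s IH] y; first by rewrite big_seq1 mem_head.
rewrite big_cons /maxn; case: ifP => _; last by rewrite mem_head.
by rewrite inE IH orbT.
Qed.

Lemma revstack_rec_fuel (w : seq nat) (j k : nat) :
  size w <= j -> size w <= k -> revstack_rec j w = revstack_rec k w.
Proof.
elim: j k w => [|j IH] [|k] [|y s] // szj szk.
have lt_i : index (\max_(x <- y :: s) x) (y :: s) < (size s).+1.
  by rewrite -[(size s).+1]/(size (y :: s)) index_mem bigmax_mem.
rewrite [LHS]/= [RHS]/=; move: lt_i; set i := index _ _ => lt_i.
have szd : size (drop i s) <= size s by rewrite size_drop leq_subr.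
have szt : size (take i (y :: s)) <= size s by rewrite size_takel // ltnW.
congr (_ ++ _); first by apply: IH; exact: leq_trans szd _.
by congr (_ ++ _); apply: IH; exact: leq_trans szt _.
Qed.

Lemma revstack_nil : revstack [::] = [::].
Proof. by []. Qed.

Lemma revstack_seq1 (y : nat) : revstack [:: y] = [:: y].
Proof. by rewrite /revstack /= big_seq1. Qed.

Lemma revstack_cat (L R : seq nat) (m : nat) :
    (forall x, x \in L ++ R -> x < m) ->
  revstack (L ++ m :: R) = revstack R ++ revstack L ++ [:: m].
Proof.
move=> ltm; have mL : m \notin L.
  by apply/negP => mL; have := ltm m; rewrite mem_cat mL ltnn => /(_ isT).
have maxE : \max_(x <- L ++ m :: R) x = m.
  apply/eqP; rewrite eqn_leq; apply/andP; split.
    apply/bigmax_leqP_seq => x; rewrite mem_cat inE orbCA -mem_cat => xw _.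
    by case/orP: xw => [/eqP-> //|/ltm/ltnW].
  by apply: leq_bigmax_seq; rewrite // mem_cat inE eqxx orbT.
have iE : index m (L ++ m :: R) = size L.
  by rewrite index_cat (negPf mL) /= eqxx addn0.
have szE : size (L ++ m :: R) = (size L + size R).+1.
  by rewrite size_cat addnS.
rewrite {1}/revstack szE; set k := (size L + size R)%N.
have -> : revstack_rec k.+1 (L ++ m :: R) =
    let w := L ++ m :: R in let M := \max_(x <- w) x in let i := index M w in
    revstack_rec k (drop i.+1 w) ++ revstack_rec k (take i w) ++ [:: M].
  by case: (L).
rewrite /= maxE iE take_size_cat // -cat_rcons drop_size_cat ?size_rcons //.
by congr (_ ++ (_ ++ _)); apply: revstack_rec_fuel;
  rewrite // /k ?leq_addr ?leq_addl.
Qed.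

Definition eulerian (m : nat) : {poly int} :=
  (\sum_(p : 'S_m) 'X^(1 + des (word_of p))%N)%R.

(* Main.v *)
Require Import Defs.
From mathcomp Require Import all_boot all_order all_fingroup all_algebra.

Set Implicit Arguments.
Unset Strict Implicit.
Unset Printing Implicit Defensive.

Import GRing.Theory.

(** One pass of revstack puts the largest letter last, and it stays there, so
    after [n - 2] passes only the letters 1 and 2 can still be out of order.
    The words that fail to be sorted have a rigid shape: they are the words
    [L ++ n :: R] in which [L] consists of the letters below [n] with the
    parity of [n], and [R] of the other letters, in arbitrary orders.

    The shape is found by induction on [n].  Since
    [T (L ++ n :: R) = T R ++ T L ++ [:: n]], the word is sorted by [n - 2]
    passes exactly when [T R ++ T L], a word on the letters up to [n - 1], is
    sorted by [n - 3] passes.  Each of [T R] and [T L] has its maximum at its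
    end.  If [n - 1] is in [R], it thus separates the remaining letters of [R]
    from those of [L], and [T R ++ T L] has the bad shape for [n - 1] exactly
    when [L ++ n :: R] has it for [n].  If [n - 1] is in [L], it comes last in
    [T R ++ T L], whereas in the bad shape some letter follows it
    ([revstack_zigzag], [iter_revstack_zigzag]).

    In [L ++ n :: R] with [R] nonempty the only descent not inside [L] or [R]
    is the one right after [n], so [1 + des] is additive ([des_cat_max]).  As
    [L] and [R] are arbitrary arrangements of alphabets of [(n - 1)./2] and
    [uphalf (n - 1)] letters, and descents depend only on the relative order
    of the letters ([big_permutations_eulerian]), the bad words contribute the
    product of two Eulerian polynomials ([big_zigzag_words]). *)

(** * Descents *)

Lemma des_cons2 (x y : nat) (s : seq nat) :
  des [:: x, y & s] = (y < x) + des (y :: s).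
Proof. by rewrite /des /= big_ord_recl. Qed.

Lemma des_small (s : seq nat) : size s <= 1 -> des s = 0.
Proof. by case: s => [|x [|y s]] // _; rewrite /des /= big_ord0. Qed.

(** The letter before [m] makes an ascent and the one after it a descent. *)
Lemma des_cat_max (L R : seq nat) (m : nat) :
    (forall x, x \in L ++ R -> x < m) -> R != [::] ->
  des (L ++ m :: R) = (des L + des R).+1.
Proof.
case: R => // y R + _; elim: L => [|x [|z L] IH] ltm.
- by rewrite /= des_cons2 (ltm y) ?mem_head // (des_small (s := [::])).
- have /ltnW : x < m by apply: ltm; rewrite mem_head.
  rewrite /= des_cons2 ltnNge => -> /=; rewrite (des_small (s := [:: x])) //.
  rewrite -[m :: _]/([::] ++ m :: y :: R) IH => [|u uR]; last first.
    by apply: ltm; rewrite inE uR orbT.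
  by rewrite (des_small (s := [::])).
rewrite [_ ++ _]/= !des_cons2 -addnA -addnS -IH // => u uR.
by apply: ltm; rewrite inE uR orbT.
Qed.

Lemma des_map_mono (f : nat -> nat) (t : seq nat) :
    {in t &, {mono f : x y / x < y}} ->
  des (map f t) = des t.
Proof.
move=> monof; rewrite /des size_map; apply: eq_bigr => i _.
have lt_i : i.+1 < size t by rewrite -ltn_predRL.
by rewrite !(nth_map 0) ?monof ?mem_nth // ltnW.
Qed.

(** * Arrangements of an alphabet *)

Definition select (s : seq nat) (p : 'S_(size s)) : seq nat :=
  [seq nth 0 s (p i) | i <- enum 'I_(size s)].

Lemma permutations_select (s : seq nat) :
  uniq s -> perm_eq (permutations s) [seq select p | p <- enum 'S_(size s)].
Proof.
move=> uniq_s; apply: uniq_perm; rewrite ?permutations_uniq //.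
  rewrite map_inj_uniq ?enum_uniq // => p q /eq_in_map eq_pq.
  apply/permP => i; apply/val_inj/eqP.
  by rewrite -(nth_uniq 0 (ltn_ord (p i)) (ltn_ord (q i)) uniq_s) eq_pq ?mem_enum.
move=> w; rewrite mem_permutations.
apply/idP/mapP => [/(@tuple_permP _ _ _ (in_tuple s))[p ->]|[p _ ->]].
  exists p; rewrite ?mem_enum //; apply: eq_map => i.
  by rewrite (tnth_nth 0).
apply/(@tuple_permP _ _ _ (in_tuple s)); exists p; apply: eq_map => i.
by rewrite (tnth_nth 0).
Qed.

Lemma des_select (s : seq nat) (p : 'S_(size s)) :
  sorted ltn s -> des (select p) = des (word_of p).
Proof.
move=> sorted_s; pose t := [seq (p i : nat) | i <- enum 'I_(size s)].
have -> : select p = map (nth 0 s) t by rewrite -map_comp.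
have -> : word_of p = map succn t by rewrite -map_comp.
rewrite !des_map_mono // => x y /mapP[i _ ->] /mapP[j _ ->].
have mono_nth := sorted_ltn_nth ltn_trans 0 sorted_s.
case: (ltngtP (p i) (p j)) => [lt_ij|lt_ji|->]; last by rewrite ltnn.
  by rewrite mono_nth ?inE.
by apply: negbTE; rewrite -leqNgt ltnW // mono_nth ?inE.
Qed.

(** The increasing enumeration of the alphabet [s] is an order isomorphism
    from the ranks, so it preserves descents. *)
Lemma big_permutations_eulerian (s : seq nat) : sorted ltn s ->
  (\sum_(w <- permutations s) 'X^(1 + des w) = eulerian (size s))%R.
Proof.
move=> sorted_s; have uniq_s := sorted_uniq ltn_trans ltnn sorted_s.
rewrite (perm_big _ (permutations_select uniq_s)) /= big_map big_enum /=.
by apply: eq_bigr => p _; rewrite des_select.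
Qed.

Lemma permutations_words (n : nat) :
  perm_eq (permutations (iota 1 n)) [seq word_of p | p <- enum 'S_n].
Proof.
have := permutations_select (iota_uniq 1 n).
have -> // : [seq select p | p <- enum 'S_(size (iota 1 n))]
          = [seq word_of p | p <- enum 'S_n].
rewrite (eq_map (g := fun p => word_of p)) ?size_iota // => p.
apply: eq_map => i.
by rewrite nth_iota // -[X in _ < X](size_iota 1).
Qed.

(** * Revstack and the largest letter *)

Lemma revstack_rcons (w : seq nat) (m : nat) :
  (forall x, x \in w -> x < m) -> revstack (rcons w m) = rcons (revstack w) m.
Proof.
move=> ltm; rewrite -cats1 revstack_cat ?cats0 //.
by rewrite revstack_nil cats1.
Qed.

Lemma revstack_max (w : seq nat) (m : nat) :
    uniq w -> m \in w -> (forall x, x \in w -> x <= m) ->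
  exists L R, w = L ++ m :: R /\ revstack w = rcons (revstack R ++ revstack L) m.
Proof.
move=> uniq_w mw; case/splitPr: mw uniq_w => L R uniq_w lem.
exists L, R; split=> //; rewrite revstack_cat ?cats1 ?rcons_cat // => x xLR.
move: uniq_w; rewrite uniq_catC cat_cons /= => /andP[mRL _].
rewrite ltn_neqAle lem ?andbT.
  by apply: contra mRL => /eqP<-; rewrite mem_cat orbC -mem_cat.
by move: xLR; rewrite !mem_cat inE => /orP[] ->; rewrite ?orbT.
Qed.

Lemma perm_revstack (w : seq nat) : uniq w -> perm_eq (revstack w) w.
Proof.
have [k] := ubnP (size w); elim: k w => // k IH [|y s] // lt_wk uniq_w.
have lem x : x \in y :: s -> x <= \max_(x <- y :: s) x.
  by move=> xw; apply: leq_bigmax_seq.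
have [L [R [def_w ->]]] := revstack_max uniq_w (bigmax_mem y s) lem.
move: (\max_(x <- y :: s) x) def_w lt_wk uniq_w => m ->.
rewrite size_cat /= addnS ltnS => lt_wk.
rewrite uniq_catC cat_cons /= => /andP[_]; rewrite cat_uniq.
case/and3P=> uniq_R _ uniq_L.
rewrite perm_rcons perm_sym perm_catC /= perm_cons perm_sym.
by rewrite perm_cat ?IH // (leq_ltn_trans _ lt_wk) ?leq_addr ?leq_addl.
Qed.

(** A final maximum is inert: this is what allows induction on the number of
    letters. *)
Lemma iter_revstack_rcons (t : nat) (w : seq nat) (m : nat) :
    uniq w -> (forall x, x \in w -> x < m) ->
  iter t revstack (rcons w m) = rcons (iter t revstack w) m.
Proof.
elim: t w => // t IH w uniq_w ltm; have perm_w := perm_revstack uniq_w.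
rewrite !iterSr revstack_rcons // IH ?(perm_uniq perm_w) // => x.
by rewrite (perm_mem perm_w); apply: ltm.
Qed.

(** * The words left unsorted *)

Lemma iota1S (n : nat) : iota 1 n.+1 = rcons (iota 1 n) n.+1.
Proof. by rewrite -[in LHS](addn1 n) iotaD cats1 add1n. Qed.

Lemma perm_iota_split (n : nat) (w : seq nat) : perm_eq w (iota 1 n.+1) ->
  exists L R, w = L ++ n.+1 :: R /\ perm_eq (L ++ R) (iota 1 n).
Proof.
move=> perm_w; have mw : n.+1 \in w by rewrite (perm_mem perm_w) mem_iota /=.
case/splitPr: mw perm_w => L R; rewrite iota1S.
rewrite perm_catC perm_sym perm_rcons perm_cons perm_sym => permRL.
by exists L, R; rewrite perm_catC.
Qed.

(** The alphabets to the right and to the left of the largest letter [m.+1] in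
    a bad word.  The parity is compared with that of [m], so the near letters
    are those of the parity opposite to [m.+1]. *)
Definition near_letters (m : nat) := [seq x <- iota 1 m | odd x == odd m].
Definition far_letters (m : nat) := [seq x <- iota 1 m | odd x != odd m].

Definition zigzag_words (m : nat) : seq (seq nat) :=
  [seq L ++ m.+1 :: R |
    L <- permutations (far_letters m), R <- permutations (near_letters m)].

(** Passing from [m] to [m.+1] exchanges the two alphabets, the new letter
    joining the near ones; this mirrors the exchange of the two sides of the
    maximum by revstack. *)
Lemma near_lettersS (m : nat) :
  near_letters m.+1 = rcons (far_letters m) m.+1.
Proof.
rewrite /near_letters iota1S filter_rcons eqxx.
by congr rcons; apply: eq_filter => x /=; case: odd; case: odd.
Qed.

Lemma far_lettersS (m : nat) : far_letters m.+1 = near_letters m.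
Proof.
rewrite /far_letters iota1S filter_rcons eqxx.
by apply: eq_filter => x /=; case: odd; case: odd.
Qed.

Lemma size_letters (m : nat) :
  size (far_letters m) = m./2 /\ size (near_letters m) = uphalf m.
Proof.
elim: m => // m [sz_far sz_near]; rewrite far_lettersS near_lettersS.
by rewrite size_rcons sz_far sz_near uphalfE.
Qed.

Lemma zigzag_wordsP (m : nat) (w : seq nat) :
  reflect (exists L R, [/\ perm_eq L (far_letters m),
                           perm_eq R (near_letters m) & w = L ++ m.+1 :: R])
          (w \in zigzag_words m).
Proof.
apply: (iffP allpairsP) => [[[L R]] /= []|[L [R [permL permR ->]]]].
  by rewrite !mem_permutations => permL permR ->; exists L, R.
by exists (L, R); rewrite !mem_permutations.
Qed.

Lemma zigzag_words_perm (m : nat) (w : seq nat) :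
  w \in zigzag_words m -> perm_eq w (iota 1 m.+1).
Proof.
case/zigzag_wordsP => L [R [permL permR ->]].
rewrite iota1S perm_sym perm_rcons perm_sym perm_catC cat_cons perm_cons.
by rewrite (perm_trans (perm_cat permR permL)) // perm_filterC.
Qed.

Lemma cat_cons_inj (m : nat) (L L' R R' : seq nat) :
    m \notin L -> m \notin L' -> L ++ m :: R = L' ++ m :: R' ->
  L = L' /\ R = R'.
Proof.
elim: L L' => [|x L IH] [|y L'] /=; rewrite ?inE ?negb_or.
- by move=> _ _ [].
- by move=> _ /andP[/eqP neq _] [].
- by move=> /andP[/eqP neq _] _ [/esym].
by move=> /andP[_ mL] /andP[_ mL'] [-> /(IH _ mL mL')[-> ->]].
Qed.

Lemma max_notin_far (m : nat) (L : seq nat) :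
  perm_eq L (far_letters m) -> m.+1 \notin L.
Proof.
by move/perm_mem=> ->; rewrite mem_filter mem_iota add1n ltnn !andbF.
Qed.

Lemma uniq_zigzag_words (m : nat) : uniq (zigzag_words m).
Proof.
apply: allpairs_uniq => [||u v]; rewrite ?permutations_uniq //.
case/allpairsP=> [[L R]] /= [LP _ ->] /allpairsP[[L' R']] /= [L'P _ ->] /=.
rewrite !mem_permutations in LP L'P.
by move/cat_cons_inj=> [||-> ->] //; apply: max_notin_far.
Qed.

Lemma mem_zigzag_words (m : nat) (L R : seq nat) : m.+1 \notin L ->
  (L ++ m.+1 :: R \in zigzag_words m)
    = perm_eq L (far_letters m) && perm_eq R (near_letters m).
Proof.
move=> mL; apply/zigzag_wordsP/andP => [[L' [R' [permL permR]]]|[]].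
  by case/(cat_cons_inj mL (max_notin_far permL)) => -> ->.
by exists L, R.
Qed.

(** The induction step.  Everything depends on the side of the maximum on
    which the second largest letter [m.+1] lies, because revstack moves that
    letter to the end of its side.  For [0 < m], the letter [m] has to follow
    [m.+1] in a bad word, which excludes the left side. *)
Lemma revstack_zigzag (m : nat) (L R : seq nat) :
    0 < m -> perm_eq (L ++ R) (iota 1 m.+1) ->
  (revstack R ++ revstack L \in zigzag_words m)
    = (L ++ m.+2 :: R \in zigzag_words m.+1).
Proof.
move=> m_gt0 permLR.
have leLR x : x \in L ++ R -> x <= m.+1.
  by rewrite (perm_mem permLR) mem_iota add1n ltnS => /andP[].
have uniqLR : uniq (L ++ R) by rewrite (perm_uniq permLR) iota_uniq.
have leL x : x \in L -> x <= m.+1 by move=> xL; rewrite leLR // mem_cat xL.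
have leR x : x \in R -> x <= m.+1.
  by move=> xR; rewrite leLR // mem_cat xR orbT.
have mLR : m.+1 \in L ++ R by rewrite (perm_mem permLR) mem_iota /= ltnS.
rewrite mem_zigzag_words; last by apply/negP => /leL; rewrite ltnn.
rewrite far_lettersS near_lettersS.
have [uniqL disjLR uniqR] := and3P (etrans (esym (cat_uniq L R)) uniqLR).
have permTL := perm_revstack uniqL; have permTR := perm_revstack uniqR.
move: mLR; rewrite mem_cat => /orP[mL | mR].
  have mR : m.+1 \notin R by apply: contra disjLR => mR; apply/hasP; exists m.+1.
  have [L1 [L2 [_ defTL]]] := revstack_max uniqL mL leL.
  have := perm_uniq permTL; rewrite uniqL defTL rcons_uniq => /andP[mQ _].
  rewrite -cats1 catA mem_zigzag_words; last first.
    by rewrite mem_cat (perm_mem permTR) (negPf mR).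
  (* [m.+1] ends [revstack L], so nothing follows it, but [m] would have to. *)
  have -> : perm_eq [::] (near_letters m) = false.
    apply/negP => /perm_mem/(_ m); rewrite mem_filter mem_iota eqxx.
    by rewrite m_gt0 add1n leqnn.
  rewrite andbF; apply/esym/negP => /andP[_ /perm_mem/(_ m.+1)].
  by rewrite mem_rcons mem_head (negPf mR).
have [R1 [R2 [_ defTR]]] := revstack_max uniqR mR leR.
have := perm_uniq permTR; rewrite uniqR defTR rcons_uniq => /andP[mQ _].
(* [m.+1] ends [revstack R], so it separates the rest of [revstack R] from
   [revstack L]. *)
rewrite cat_rcons mem_zigzag_words // andbC (permPl permTL); congr andb.
rewrite -(permPl permTR) defTR perm_rcons.
by rewrite [RHS]perm_sym perm_rcons perm_cons perm_sym.
Qed.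

(** The induction starts at two letters, where no pass is made and the only
    bad word is 21. *)
Lemma iter_revstack_zigzag (m : nat) (w : seq nat) :
    0 < m -> perm_eq w (iota 1 m.+1) ->
  (iter m.-1 revstack w == iota 1 m.+1) = (w \notin zigzag_words m).
Proof.
case: m => // m _; elim: m w => [|m IH] w perm_w.
  have [L [R [def_w permLR]]] := perm_iota_split perm_w; subst w.
  have [[-> ->]|[-> ->]] : (L = [:: 1] /\ R = [::]) \/ (L = [::] /\ R = [:: 1]).
    have := perm_small_eq (isT : size [:: 1] <= 1) permLR.
    by case: L {perm_w permLR} => [|x [|y L]] //= []; [right | move=> -> ->; left].
  - by rewrite mem_zigzag_words.
  by rewrite mem_zigzag_words.
have [L [R [def_w permLR]]] := perm_iota_split perm_w; subst w.
rewrite -revstack_zigzag //; set v := revstack R ++ revstack L.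
have lt_m x : x \in L ++ R -> x < m.+3.
  by rewrite (perm_mem permLR) mem_iota add1n => /andP[].
have perm_v : perm_eq v (iota 1 m.+2).
  rewrite -(permPr permLR) perm_sym perm_catC perm_sym.
  have: uniq (L ++ R) by rewrite (perm_uniq permLR) iota_uniq.
  rewrite cat_uniq => /and3P[uniqL _ uniqR].
  by rewrite perm_cat ?perm_revstack.
rewrite -IH // iterSr revstack_cat // catA cats1 iter_revstack_rcons.
- by rewrite [in LHS]iota1S eqseq_rcons eqxx andbT.
- by rewrite (perm_uniq perm_v) iota_uniq.
by move=> x; rewrite (perm_mem perm_v) mem_iota add1n => /andP[].
Qed.

(** * The descent polynomial *)

Lemma big_zigzag_words (m : nat) : 0 < m ->
  (\sum_(w <- zigzag_words m) 'X^(1 + des w)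
   = eulerian (uphalf m) * eulerian m./2)%R.
Proof.
move=> m_gt0; have [<- <-] := size_letters m.
have sorted_filter_iota a : sorted ltn (filter a (iota 1 m)).
  exact: sorted_filter ltn_trans _ _ (iota_ltn_sorted 1 m).
have sorted_far : sorted ltn (far_letters m) by apply: sorted_filter_iota.
have sorted_near : sorted ltn (near_letters m) by apply: sorted_filter_iota.
rewrite -!big_permutations_eulerian // mulrC big_distrl /= big_allpairs_dep.
apply: eq_big_seq => L; rewrite mem_permutations => permL.
rewrite big_distrr /=; apply: eq_big_seq => R; rewrite mem_permutations => permR.
have near_m : m \in R by rewrite (perm_mem permR) mem_filter eqxx mem_iota m_gt0 /=.
rewrite des_cat_max => [|x|]; last by apply: contraTneq near_m => ->.
  by rewrite -exprD !add1n addSn addnS.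
rewrite mem_cat (perm_mem permL) (perm_mem permR) !mem_filter.
by rewrite mem_iota add1n => /orP[] /and3P[].
Qed.

Theorem theorem3p3 (n : nat) (hn : (4 <= n)%N) :
  (\sum_(p : 'S_n | iter (n - 2)%N revstack (word_of p) == iota 1 n)
      'X^(1 + des (word_of p))%N
   = eulerian n - eulerian (uphalf (n - 1)%N) * eulerian ((n - 1)./2)%N)%R.
Proof.
case: n hn => // m hm; have m_gt0 : 0 < m by case: m hm.
rewrite subSS !subn1 -big_zigzag_words //.
have perm_word (p : 'S_m.+1) : perm_eq (word_of p) (iota 1 m.+1).
  rewrite -mem_permutations (perm_mem (permutations_words _)).
  by rewrite map_f ?mem_enum.
rewrite (eq_bigl (fun p => word_of p \notin zigzag_words m)); last first.
  by move=> p; rewrite iter_revstack_zigzag.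
rewrite [eulerian m.+1](bigID (fun p => word_of p \in zigzag_words m)) /= addrC.
suff -> : (\sum_(p : 'S_m.+1 | word_of p \in zigzag_words m)
             'X^(1 + des (word_of p))
           = \sum_(w <- zigzag_words m) 'X^(1 + des w) :> {poly int})%R.
  by rewrite addrK.
transitivity (\sum_(w <- permutations (iota 1 m.+1) | w \in zigzag_words m)
                'X^(1 + des w) : {poly int})%R.
  by rewrite (perm_big _ (permutations_words _)) big_map big_enum_cond.
rewrite -big_filter; apply: perm_big; apply: uniq_perm.
- by rewrite filter_uniq ?permutations_uniq.
- exact: uniq_zigzag_words.
move=> w; rewrite mem_filter mem_permutations /=.
by apply/andP/idP => [[]|zw] //; rewrite zigzag_words_perm.
Qed.
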